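(* If $d_1,d_2,d_3>0$ and $$L_{123} \begin{vmatrix}4L_{123}&L_{111}'\\L_{111}'&4L_{123}\end{vmatrix} \begin{vmatrix}4L_{123}&L_{222}'\\L_{222}'&4L_{123}\end{vmatrix} \begin{vmatrix}4L_{123}&L_{333}'\\L_{333}'&4L_{123}\end{vmatrix} \begin{vmatrix}4L_{123}&L_{111}'&L_{222}'\\L_{111}'&4L_{123}&L_{333}'\\L_{222}'&L_{333}'&4L_{123}\end{vmatrix}$$ does not vanish, then the system $$\frac{L_{111}'}{x_1}+2L_{123}\Big(\frac{x_2}{x_1x_3}+\frac{x_3}{x_1x_2}-\frac{x_1}{x_2x_3}\Big)+4d_1=0,$$ $$\frac{L_{222}'}{x_2}+2L_{123}\Big(\frac{x_1}{x_2x_3}+\frac{x_3}{x_1x_2}-\frac{x_2}{x_1x_3}\Big)+4d_2=0,$$ $$\frac{L_{333}'}{x_3}+2L_{123}\Big(\frac{x_1}{x_2x_3}+\frac{x_2}{x_1x_3}-\frac{x_3}{x_1x_2}\Big)+4d_3=0$$ has exactly $4$ solutions in $(\mathbb C^* )^3$, counted with multiplicity.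
   Context: Vertical bars denote determinants. $L_{123}$, $b_i$, $d_i$ are parameters and $L'_{iii}=-2b_id_i$ for $i=1,2,3$. *)

(* Defs.v *)
From mathcomp Require Export all_boot all_order all_algebra.
From mathcomp Require Export fraction complex mpoly reals.

Set Implicit Arguments.
Unset Strict Implicit.
Unset Printing Implicit Defensive.

Import GRing.Theory.
Local Open Scope ring_scope.

Section LocalMultiplicity.
Variables (n : nat) (K : fieldType).

Notation ratfun := {fraction {mpoly K[n]}}.

Definition ratC (c : K) : ratfun := tofrac (c%:MP_[n]).
Definition ratX (i : 'I_n) : ratfun := tofrac ('X_i : {mpoly K[n]}).

(* Membership in the local ring O_p of affine n-space at p, viewed as a
   subring of K(X_1, ..., X_n). *)
Definition regular_at (p : 'I_n -> K) (f : ratfun) : Prop :=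
  exists g h : {mpoly K[n]}, h.@[p] != 0 /\ f = tofrac g / tofrac h.

(* The ideal of O_p generated by F; meaningful when each F i lies in O_p. *)
Definition in_local_ideal (p : 'I_n -> K) (m : nat) (F : 'I_m -> ratfun)
    (f : ratfun) : Prop :=
  exists a : 'I_m -> ratfun,
    (forall j, regular_at p (a j)) /\ f = \sum_(j < m) a j * F j.

(* dim_K (O_p / (F_1, ..., F_m)) = mu, i.e. the quotient has a K-basis
   represented by e_1, ..., e_mu.  In particular this dimension is finite. *)
Definition has_multiplicity (p : 'I_n -> K) (m : nat) (F : 'I_m -> ratfun)
    (mu : nat) : Prop :=
  exists e : 'I_mu -> ratfun,
    (forall k, regular_at p (e k)) /\
    forall f, regular_at p f ->
      exists! c : 'rV[K]_mu,
        in_local_ideal p F (f - \sum_(k < mu) ratC (c 0 k) * e k).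

End LocalMultiplicity.

Definition Lprime (K : pzRingType) (b d : K) : K := - (2 * b * d).

(* The left-hand sides of the system, over an arbitrary field: it is evaluated
   both at points of C^3 and at the indeterminates of C(X_1, X_2, X_3). *)
Definition lhs (K : fieldType) (L : K) (b d x : 'I_3 -> K) (i : 'I_3) : K :=
  let x1 := x 0 in let x2 := x 1 in let x3 := x 2 in
  let L' j := Lprime (b j) (d j) in
  tnth [tuple
    L' 0 / x1
      + 2 * L * (x2 / (x1 * x3) + x3 / (x1 * x2) - x1 / (x2 * x3)) + 4 * d 0;
    L' 1 / x2
      + 2 * L * (x1 / (x2 * x3) + x3 / (x1 * x2) - x2 / (x1 * x3)) + 4 * d 1;
    L' 2 / x3
      + 2 * L * (x1 / (x2 * x3) + x2 / (x1 * x3) - x3 / (x1 * x2)) + 4 * d 2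
  ] i.

Definition torus_solution (K : fieldType) (L : K) (b d : 'I_3 -> K)
    (x : 'I_3 -> K) : Prop :=
  (forall i, x i != 0) /\ (forall i, lhs L b d x i = 0).

Definition lhs_ratfun (K : fieldType) (L : K) (b d : 'I_3 -> K) (i : 'I_3) :
    {fraction {mpoly K[3]}} :=
  lhs (ratC 3 L) (fun j => ratC 3 (b j)) (fun j => ratC 3 (d j))
      (ratX K (n:=3)) i.

(* Finitely many solutions in (K^* )^3, with multiplicities adding up to N. *)
Definition torus_solutions_count (K : fieldType) (L : K) (b d : 'I_3 -> K)
    (N : nat) : Prop :=
  exists (s : seq {ffun 'I_3 -> K}) (mu : {ffun 'I_3 -> K} -> nat),
    [/\ uniq s,
        forall x : {ffun 'I_3 -> K}, x \in s <-> torus_solution L b d x,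
        forall x : {ffun 'I_3 -> K}, x \in s ->
          has_multiplicity x (lhs_ratfun L b d) (mu x)
      & (\sum_(x <- s) mu x)%N = N].

Definition mx2 (K : pzRingType) (a11 a12 a21 a22 : K) : 'M[K]_2 :=
  \matrix_(i, j) nth 0 (nth [::] [:: [:: a11; a12]; [:: a21; a22]] i) j.

Definition mx3 (K : pzRingType) (a11 a12 a13 a21 a22 a23 a31 a32 a33 : K) :
    'M[K]_3 :=
  \matrix_(i, j) nth 0 (nth [::] [:: [:: a11; a12; a13];
                                     [:: a21; a22; a23];
                                     [:: a31; a32; a33]] i) j.

(* Main.v *)
Require Import Defs.
From HB Require Import structures.
From mathcomp Require Import spectral ring.
Import Order.TTheory GRing.Theory Num.Theory.

Set Implicit Arguments.
Unset Strict Implicit.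
Unset Printing Implicit Defensive.

Local Open Scope ring_scope.

(** Adding the equations in pairs and clearing denominators turns the system on
the torus into three quadrics x_2 x_3 = l_1(x), x_1 x_3 = l_2(x),
x_1 x_2 = l_3(x), where the coefficient matrix of the linear forms l_i is, up to
nonzero row scalings and a permutation, the 3x3 matrix of the statement. By
Bezout one expects 8 intersections, of which 3 at infinity, 1 at the origin, and
4 in the torus. Algebraically, these relations determine the multiplication
table of the 4-dimensional algebra of functions on the torus solutions in the
basis x_1, x_2, x_3, x_1 x_2 x_3: L_123 <> 0 makes x_i^2 expressible, and the
other determinants make every x_i act invertibly.

The multiplicities are then counted by linear algebra. Let A_i be the commuting
matrices of multiplication by x_i and let t be a polynomial separating the
finitely many solutions. The generalized eigenspace of t(A) for the eigenvalue
t(p) is isomorphic to the local ring at p modulo the system, and these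
eigenspaces decompose the 4-dimensional space. *)

Lemma tofrac_div_cancel (R : idomainType) (a b c d : R) : d != 0 ->
  tofrac (a * b) / tofrac c
    = tofrac (a * d) / tofrac c * (tofrac b / tofrac d) :> {fraction R}.
Proof.
rewrite -tofrac_eq0 => d0; rewrite !tofracM [_ * tofrac d / _]mulrAC mulrACA.
by rewrite divff // mulr1 mulrAC.
Qed.

Lemma tofrac_subr_div (R : idomainType) (a b c : R) : b != 0 ->
  tofrac a / tofrac b - tofrac c = tofrac (a - b * c) / tofrac b
    :> {fraction R}.
Proof.
rewrite -tofrac_eq0 => b0; rewrite tofracB tofracM mulrBl.
by rewrite [_ * _ / _]mulrAC divff // mul1r.
Qed.

(** * Local ideals of polynomial systems *)

Section LocalIdeal.
Variables (n : nat) (K : fieldType) (m : nat) (P : 'I_m -> {mpoly K[n]}).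
Variable p : 'I_n -> K.

(** Polynomials lying in the ideal that the [P j] generate in the local ring at [p], stated without
    fractions: [h] collects denominators, which are units at [p]. *)
Definition local_ideal (g : {mpoly K[n]}) : Prop :=
  exists (h : {mpoly K[n]}) (c : 'I_m -> {mpoly K[n]}),
    h.@[p] != 0 /\ h * g = \sum_j c j * P j.

Lemma local_idealD g1 g2 :
  local_ideal g1 -> local_ideal g2 -> local_ideal (g1 + g2).
Proof.
move=> [h1 [c1 [h1p e1]]] [h2 [c2 [h2p e2]]].
exists (h1 * h2), (fun j => h2 * c1 j + h1 * c2 j).
rewrite mevalM mulf_neq0 //; split=> //.
transitivity (h2 * (h1 * g1) + h1 * (h2 * g2)); first by ring.
rewrite e1 e2 !mulr_sumr -big_split; apply: eq_bigr => j _ /=; ring.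
Qed.

Lemma local_idealMl f g : local_ideal g -> local_ideal (f * g).
Proof.
move=> [h [c [hp e]]]; exists h, (fun j => f * c j); split=> //.
by rewrite mulrCA e mulr_sumr; apply: eq_bigr => j _; rewrite mulrA.
Qed.

Lemma local_ideal_gen j : local_ideal (P j).
Proof.
exists 1, (fun k => (k == j)%:R); rewrite meval1 oner_eq0; split=> //.
rewrite (bigD1 j) //= eqxx !mul1r big1 ?addr0 // => k /negPf->.
by rewrite mul0r.
Qed.

Lemma local_ideal0 : local_ideal 0.
Proof.
exists 1, (fun=> 0); rewrite meval1 oner_eq0 mulr0; split=> //.
by rewrite big1 // => j _; rewrite mul0r.
Qed.

Lemma local_idealN g : local_ideal g -> local_ideal (- g).
Proof. by rewrite -mulN1r; apply: local_idealMl. Qed.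

Lemma local_idealB g1 g2 :
  local_ideal g1 -> local_ideal g2 -> local_ideal (g1 - g2).
Proof. by move=> ? ?; apply/local_idealD/local_idealN. Qed.

Lemma local_ideal_sum (I : finType) (g : I -> {mpoly K[n]}) :
  (forall i, local_ideal (g i)) -> local_ideal (\sum_i g i).
Proof.
move=> ?; elim/big_ind: _ => //; [exact: local_ideal0 | exact: local_idealD].
Qed.

Lemma local_ideal_cancel h g : h.@[p] != 0 ->
  local_ideal (h * g) -> local_ideal g.
Proof.
move=> hp [h' [c [h'p e]]]; exists (h' * h), c.
by rewrite mevalM mulf_neq0 // -mulrA.
Qed.

Lemma local_ideal_eval g : (forall j, (P j).@[p] = 0) ->
  local_ideal g -> g.@[p] = 0.
Proof.
move=> P0 [h [c [hp /(congr1 (meval p))]]].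
rewrite mevalM raddf_sum big1 /= => [|j _]; last by rewrite mevalM P0 mulr0.
by move/eqP; rewrite mulf_eq0 (negPf hp) => /eqP.
Qed.

Lemma tofrac_neq0 (h : {mpoly K[n]}) : h.@[p] != 0 -> tofrac h != 0.
Proof.
by apply: contraNneq => /eqP; rewrite tofrac_eq0 => /eqP->; rewrite meval0.
Qed.

Lemma local_frac_sum (I : finType) (f : I -> {fraction {mpoly K[n]}}) :
    (forall i, exists g h, [/\ h.@[p] != 0, f i = tofrac g / tofrac h
                              & local_ideal g]) ->
  exists g h, [/\ h.@[p] != 0, \sum_i f i = tofrac g / tofrac h
                 & local_ideal g].
Proof.
move=> fP; elim/big_ind: _ => //.
  exists 0, 1; rewrite meval1 oner_eq0 tofrac0 mul0r; split=> //.
  exact: local_ideal0.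
move=> _ _ [g1 [h1 [h1p -> g1P]]] [g2 [h2 [h2p -> g2P]]].
exists (h2 * g1 + h1 * g2), (h1 * h2); rewrite mevalM mulf_neq0 //; split=> //.
  rewrite addf_div ?tofrac_neq0 // tofracD !tofracM.
  by rewrite ![tofrac h2 * _]mulrC ![tofrac h1 * _]mulrC.
by apply: local_idealD; apply: local_idealMl.
Qed.

Variables (F : 'I_m -> {fraction {mpoly K[n]}}) (D : {mpoly K[n]}).
Hypothesis FE : forall j, F j = tofrac (P j) / tofrac D.
Hypothesis Dp : D.@[p] != 0.

(** [D] and [h] are units of the local ring at [p], so the [F j] and the [P j] generate the same
    ideal and [h] does not affect membership. *)
Lemma in_local_ideal_frac g h : h.@[p] != 0 ->
  in_local_ideal p F (tofrac g / tofrac h) <-> local_ideal g.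
Proof.
move=> hp; have h0 := tofrac_neq0 hp; have D0 := tofrac_neq0 Dp; split.
  move=> [a [aP e]].
  have [|g' [h' [h'p e' g'P]]] := @local_frac_sum _ (fun j => a j * F j).
    move=> j; have [b [k [kp ->]]] := aP j; have k0 := tofrac_neq0 kp.
    exists (b * P j), (k * D); rewrite mevalM mulf_neq0 //; split=> //.
      by rewrite FE mulf_div !tofracM.
    exact/local_idealMl/local_ideal_gen.
  apply: (local_ideal_cancel h'p); suff ->: h' * g = h * g'.
    exact: local_idealMl.
  apply/eqP; rewrite -tofrac_eq !tofracM mulrC [eqbRHS]mulrC.
  by rewrite -eqr_div ?tofrac_neq0 // e e'.
move=> [k [c [kp e]]]; have k0 := tofrac_neq0 kp.
exists (fun j => tofrac (c j * D) / tofrac (k * h)); split.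
  by move=> j; exists (c j * D), (k * h); rewrite mevalM mulf_neq0.
transitivity (tofrac (k * g) / tofrac (k * h)).
  by rewrite !tofracM -mulf_div divff // mul1r.
rewrite e raddf_sum mulr_suml; apply: eq_bigr => j _.

rewrite FE; apply: tofrac_div_cancel.
by apply: contraNneq Dp => ->; rewrite meval0.
Qed.

End LocalIdeal.

(** * Polynomials in commuting matrices *)

Section MatrixEvaluation.
Variables (n N : nat) (K : fieldType) (A : 'I_n -> 'M[K]_N.+1).
Hypothesis AC : forall i j, GRing.comm (A i) (A j).

Lemma mpoly_ring_ind (Q : {mpoly K[n]} -> Prop) :
    (forall c, Q c%:MP) -> (forall i, Q 'X_i) ->
    (forall f g, Q f -> Q g -> Q (f + g)) ->
    (forall f g, Q f -> Q g -> Q (f * g)) ->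
  forall g, Q g.
Proof.
move=> QC QX QD QM g; rewrite [g]mpolyE.
elim/big_ind: _ => [||k _]; [by rewrite -mpolyC0 | by [] |].
rewrite -mul_mpolyC; apply: (QM _ _ (QC _)); rewrite mpolyXE_id.
elim/big_ind: _ => [||i _]; [by rewrite -mpolyC1 | by [] |].
elim: (k i) => [|e IH]; first by rewrite expr0 -mpolyC1.
by rewrite exprS; apply: QM.
Qed.

Definition mxeval (g : {mpoly K[n]}) : 'M[K]_N.+1 :=
  mmap (@scalar_mx K N.+1) A g.

HB.instance Definition _ :=
  GRing.isZmodMorphism.Build {mpoly K[n]} 'M[K]_N.+1 mxeval
    (mmap_is_additive A (@scalar_mx K N.+1)).

Lemma mxevalC c : mxeval c%:MP = c%:M.
Proof. exact: mmapC. Qed.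

Lemma mxevalX i : mxeval 'X_i = A i.
Proof. by rewrite /mxeval mmapX mmap1U. Qed.

Lemma mxevalZ c g : mxeval (c *: g) = c *: mxeval g.
Proof. by rewrite /mxeval mmapZ -mulmxE mul_scalar_mx. Qed.

Lemma mxeval_sum (I : finType) (f : I -> {mpoly K[n]}) :
  mxeval (\sum_i f i) = \sum_i mxeval (f i).
Proof. exact: raddf_sum. Qed.

Lemma mxeval_multiplicative : monoid_morphism mxeval.
Proof.
split; first by rewrite -mpolyC1 mxevalC.
have mul1 k1 k2 : mmap1 A (k1 + k2) = mmap1 A k1 * mmap1 A k2.
  rewrite /mmap1 -prodrM_comm => [|i j _ _].
    by apply: eq_bigr => i _; rewrite mnmDE exprD.
  exact/commrX/commr_sym/commrX/commr_sym.
move=> f g; rewrite [f]mpolyE [g]mpolyE mulr_suml !raddf_sum /= mulr_suml.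
apply: eq_bigr => k1 _; rewrite mulr_sumr !raddf_sum /= mulr_sumr.
apply: eq_bigr => k2 _.
rewrite -scalerAl -scalerAr -mpolyXD !mxevalZ /mxeval !mmapX mul1.
by rewrite -scalerAl -scalerAr.
Qed.

HB.instance Definition _ :=
  GRing.isMonoidMorphism.Build {mpoly K[n]} 'M[K]_N.+1 mxeval
    mxeval_multiplicative.

Lemma mxevalM f g : mxeval (f * g) = mxeval f *m mxeval g.
Proof. exact: rmorphM. Qed.

Lemma mxeval_comm f g : mxeval f *m mxeval g = mxeval g *m mxeval f.
Proof. by rewrite !mulmxE -!rmorphM mulrC. Qed.

Lemma mxeval_stable (W : 'M_N.+1) f :
  (forall i, stablemx W (A i)) -> stablemx W (mxeval f).
Proof.
move=> AW; elim/mpoly_ring_ind: f => [c|i|f g|f g].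
- by rewrite mxevalC stablemxC.
- by rewrite mxevalX.
- by move=> fW gW; rewrite raddfD stablemxD.
- by move=> fW gW; rewrite mxevalM stablemxM.
Qed.

Lemma mxeval_eigen (w : 'rV_N.+1) x f :
  (forall i, w *m A i = x i *: w) -> w *m mxeval f = f.@[x] *: w.
Proof.
move=> wA; elim/mpoly_ring_ind: f => [c|i|f g|f g].
- by rewrite mxevalC mul_mx_scalar mevalC.
- by rewrite mxevalX mevalXU.
- by move=> fw gw; rewrite raddfD mulmxDr mevalD scalerDl fw gw.
- move=> fw gw; rewrite rmorphM /= -mulmxE mulmxA fw -scalemxAl gw scalerA.
  by rewrite mevalM.
Qed.

Lemma mxeval_horner (Q : {poly K}) t :
  mxeval (map_poly (@mpolyC n K) Q).[t] = horner_mx (mxeval t) Q.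
Proof.
elim/poly_ind: Q => [|Q c IH]; first by rewrite !raddf0 horner0 raddf0.
rewrite !rmorphD !rmorphM /= !map_polyC map_polyX !hornerE.
by rewrite rmorphD rmorphM /= IH mxevalC horner_mx_X horner_mx_C.
Qed.

Lemma meval_horner (Q : {poly K}) (t : {mpoly K[n]}) x :
  (map_poly (@mpolyC n K) Q).[t].@[x] = Q.[t.@[x]].
Proof.
elim/poly_ind: Q => [|Q c IH]; first by rewrite raddf0 !horner0 raddf0.
rewrite !rmorphD !rmorphM /= !map_polyC map_polyX !hornerE.
by rewrite mevalD mevalM IH mevalC.
Qed.

(** * Multiplicity at a point as the rank of a stable subspace *)

Section Multiplicity.
Variables (m : nat) (P : 'I_m -> {mpoly K[n]}).
Variables (u : 'I_N.+1 -> {mpoly K[n]}) (v : 'rV[K]_N.+1) (p : 'I_n -> K).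
(** Row vectors are coordinates in the [u k]. By [vu], [v] represents 1; by [uA], the [A i] give the
    multiplication table locally at [p]. *)
Hypothesis AP : forall j, mxeval (P j) = 0.
Hypothesis vu : forall k, v *m mxeval (u k) = delta_mx 0 k.
Hypothesis uA : forall i k,
  local_ideal P p ('X_i * u k - \sum_l A i k l *: u l).
Hypothesis u_neq0 : exists k, (u k).@[p] != 0.

Definition lincomb (r : 'rV[K]_N.+1) : {mpoly K[n]} := \sum_k r 0 k *: u k.

Lemma lincomb_is_linear : linear lincomb.
Proof.
move=> a r s; rewrite scaler_sumr -big_split; apply: eq_bigr => k _ /=.
by rewrite !mxE scalerA scalerDl.
Qed.

HB.instance Definition _ :=
  GRing.isLinear.Build K 'rV[K]_N.+1 {mpoly K[n]} _ lincomb lincomb_is_linear.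

Lemma lincomb_delta k : lincomb (delta_mx 0 k) = u k.
Proof.
rewrite /lincomb (bigD1 k) //= mxE !eqxx scale1r big1 ?addr0 // => l /negPf lk.
by rewrite mxE lk andbF scale0r.
Qed.

Lemma mulmx_lincomb r : v *m mxeval (lincomb r) = r.
Proof.
rewrite {1}/lincomb mxeval_sum mulmx_sumr [RHS]row_sum_delta.
apply: eq_bigr => k _ /=.
by rewrite mxevalZ -scalemxAr vu.
Qed.

(* Multiplication by g modulo the local ideal is given on coordinates in the
   u k by the matrix of g, acting on row vectors. *)
Lemma mul_lincomb g r :
  local_ideal P p (g * lincomb r - lincomb (r *m mxeval g)).
Proof.
elim/mpoly_ring_ind: g r => [c|i|f g IHf IHg|f g IHf IHg] r.
- rewrite mxevalC mul_mx_scalar linearZ /= mul_mpolyC subrr.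
  exact: local_ideal0.
- rewrite mxevalX; set h := (X in local_ideal _ _ X).
  have -> : h = \sum_k (r 0 k)%:MP * ('X_i * u k - \sum_l A i k l *: u l).
    rewrite /h {1}/lincomb mulr_sumr {2}[r]row_sum_delta mulmx_suml.
    rewrite (linear_sum lincomb) -sumrB; apply: eq_bigr => k _ /=.
    rewrite mul_mpolyC scalerBr.
    congr (_ - _); first by rewrite -scalerAr.
    rewrite -scalemxAl linearZ /= -rowE; congr (_ *: _); apply: eq_bigr => l _.
    by rewrite mxE.
  by apply: local_ideal_sum => k; apply: local_idealMl.
- rewrite raddfD /= mulmxDr linearD /= mulrDl opprD addrACA.
  exact: local_idealD.
- rewrite rmorphM /= -mulmxE mxeval_comm mulmxA.
  set s := r *m mxeval g.
  rewrite (_ : f * g * _ - _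
      = f * (g * lincomb r - lincomb s)
        + (f * lincomb s - lincomb (s *m mxeval f))); last by ring.
  by apply: local_idealD => //; apply: local_idealMl.
Qed.

(** By [mul_lincomb], [g * u k] lies in the local ideal for every [k], and some [u k] is a unit at
    [p]. *)
Lemma mxeval_eq0 g : mxeval g = 0 -> local_ideal P p g.
Proof.
move=> g0; have [k uk] := u_neq0; apply: (local_ideal_cancel uk).
have := mul_lincomb g (delta_mx 0 k).
by rewrite g0 mulmx0 raddf0 subr0 lincomb_delta mulrC.
Qed.

(** [lincomb v] acts as the identity: it fixes [v], and each unit vector is the image of [v] under
    the matrix of some [u k], which commutes with its own. *)
Lemma lincomb_one : local_ideal P p (lincomb v - 1).
Proof.
apply: mxeval_eq0; rewrite (rmorphB mxeval) (rmorph1 mxeval).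
apply/eqP; rewrite subr_eq0; apply/eqP/row_matrixP => k.
by rewrite !rowE -vu -mulmxA mxeval_comm mulmxA mulmx_lincomb mulmx1.
Qed.

(** [W] stands for the part of the space supported at [p]: polynomials that do not vanish at [p] act
    injectively on it. The polynomial [q] acts as an idempotent that sends [v], representing 1, into
    [W]. *)
Variable W : 'M[K]_N.+1.
Hypothesis W_stable : forall i, stablemx W (A i).
Hypothesis W_inj : forall h (w : 'rV_N.+1), h.@[p] != 0 -> (w <= W)%MS ->
  w *m mxeval h = 0 -> w = 0.
Variable q : {mpoly K[n]}.
Hypothesis q_neq0 : q.@[p] != 0.
Hypothesis vqW : (v *m mxeval q <= W)%MS.
Hypothesis q_idem : mxeval ((1 - q) * q) = 0.

(** Being injective on [W], [h] acts bijectively there by rank-nullity, so some [z] in [W] satisfies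
    [z *m mxeval h = v *m mxeval q]. Hence [h * lincomb z] is congruent to [q], and [q] to 1 because
    [(1 - q) * q] acts by zero and [q] is a unit at [p]. *)
Lemma inverse_mod_local_ideal h : h.@[p] != 0 ->
  exists z, (z <= W)%MS /\ local_ideal P p (h * lincomb z - 1).
Proof.
move=> hp.
have Wh : (W <= W *m mxeval h)%MS.
  have: (W *m mxeval h <= W)%MS by apply: mxeval_stable.
  move/mxrank_leqif_sup/geq_leqif => <-.
  rewrite -(mxrank_mul_ker W (mxeval h)) (_ : (_ :&: _)%MS = 0).
    by rewrite mxrank0 addn0.
  apply/eqP/rowV0P => w; rewrite sub_capmx => /andP[wW /sub_kermxP].
  exact: W_inj.
have [z0 z0E] := submxP (submx_trans vqW Wh).
exists (z0 *m W); rewrite submxMl; split=> //.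
set z := z0 *m W.
have zE : z *m mxeval h = v *m mxeval q by rewrite z0E mulmxA.
have q1 : local_ideal P p (1 - q).
  by apply: (local_ideal_cancel q_neq0); rewrite mulrC; apply: mxeval_eq0.
rewrite (_ : _ - 1 = (h * lincomb z - lincomb (z *m mxeval h))
   - (q * lincomb v - lincomb (v *m mxeval q)) + q * (lincomb v - 1)
   - (1 - q)); last by rewrite zE; ring.
apply: local_idealB q1; apply: local_idealD.
  by apply: local_idealB; apply: mul_lincomb.
exact/local_idealMl/lincomb_one.
Qed.

Variables (F : 'I_m -> {fraction {mpoly K[n]}}) (D : {mpoly K[n]}).
Hypothesis FE : forall j, F j = tofrac (P j) / tofrac D.
Hypothesis Dp : D.@[p] != 0.

Lemma has_multiplicity_rank : has_multiplicity p F (\rank W).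
Proof.
pose e k := lincomb (row k (row_base W)).
have sumE (c : 'rV_(\rank W)) :
    \sum_k ratC n (c 0 k) * tofrac (e k) = tofrac (lincomb (c *m row_base W)).
  rewrite mulmx_sum_row (linear_sum lincomb) raddf_sum.
  apply: eq_bigr => k _ /=.
  by rewrite linearZ /= -mul_mpolyC tofracM.
have bP g h (c : 'rV_(\rank W)) : h.@[p] != 0 ->
  in_local_ideal p F
    (tofrac g / tofrac h - \sum_k ratC n (c 0 k) * tofrac (e k))
  <-> local_ideal P p (g - h * lincomb (c *m row_base W)).
  move=> hp; rewrite sumE -(in_local_ideal_frac FE Dp _ hp).
  by rewrite tofrac_subr_div //; apply: contraNneq hp => ->; rewrite meval0.
exists (fun k => tofrac (e k)); split.
  by move=> k; exists (e k), 1; rewrite meval1 oner_eq0 tofrac1 divr1.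
move=> f [g [h [hp ->]]].
(* Spanning: [lincomb z] inverts [h], so [g / h] is congruent to [g * lincomb z], whose coordinates
   [z *m mxeval g] stay in the stable [W]. *)
have [z [zW hz]] := inverse_mod_local_ideal hp.
have wW : (z *m mxeval g <= row_base W)%MS.
  by rewrite eq_row_base (submx_trans (submxMr _ zW)) ?mxeval_stable.
have [c cE] := submxP wW.
have Hc : local_ideal P p (g - h * lincomb (c *m row_base W)).
  rewrite -cE.
  rewrite (_ : _ - _ = h * (g * lincomb z - lincomb (z *m mxeval g))
                       - g * (h * lincomb z - 1)); last by ring.
  by apply: local_idealB; apply: local_idealMl => //; apply: mul_lincomb.
exists c; split; first exact/bP.
(* Independence: letting a local relation act on [v] kills every [P j] and leaves a vector of [W]
   annihilated by [k * h], which [W_inj] forces to be zero. *)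
move=> c' /(bP _ _ _ hp) Hc'.
have [k [a [kp]]] : local_ideal P p (h * lincomb ((c - c') *m row_base W)).
  rewrite mulmxBl raddfB /= mulrBr.
  rewrite (_ : _ - _ = (g - h * lincomb (c' *m row_base W))
                       - (g - h * lincomb (c *m row_base W))); last by ring.
  exact: local_idealB.
move/(congr1 (fun f => v *m mxeval f)); rewrite mulrA mulrC rmorphM /= -mulmxE.
rewrite mulmxA mulmx_lincomb mxeval_sum big1 => [|j _]; last first.
  by rewrite rmorphM /= AP mulr0.
rewrite mulmx0 => /W_inj; rewrite mevalM mulf_neq0 // => /(_ isT).
rewrite -(eq_row_base W) submxMl => /(_ isT) /eqP.
by rewrite mulmx_free_eq0 ?row_base_free // subr_eq0 => /eqP.
Qed.

End Multiplicity.
End MatrixEvaluation.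

(** Lagrange interpolation of the index in [s]; characteristic zero keeps the indices distinct in
    [K]. *)
Lemma separating_mpoly (K : numFieldType) n (s : seq {ffun 'I_n -> K}) :
  uniq s ->
  exists t : {mpoly K[n]},
    {in s &, injective (fun x : {ffun 'I_n -> K} => t.@[x])}.
Proof.
move=> s_uniq.
(* [l x y] vanishes at [y] but not at [x], so the product [q x] vanishes on [s] except at [x]. *)
pose l (x y : {ffun 'I_n -> K}) : {mpoly K[n]} :=
  if [pick i | x i != y i] is Some i then 'X_i - (y i)%:MP else 1.
have lx (x y : {ffun 'I_n -> K}) : x != y -> (l x y).@[x] != 0.
  rewrite /l => xy; case: pickP => [i xyi|_]; last by rewrite meval1 oner_eq0.
  by rewrite mevalB mevalXU mevalC subr_eq0.
have ly (x y : {ffun 'I_n -> K}) : x != y -> (l x y).@[y] = 0.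
  rewrite /l => xy; case: pickP => [i _|e].
    by rewrite mevalB mevalXU mevalC subrr.
  by case/eqP: xy; apply/ffunP => i; apply/eqP; move/negbFE: (e i).
pose q (x : {ffun 'I_n -> K}) := \prod_(y <- s | y != x) l x y.
have qE (x z : {ffun 'I_n -> K}) :
    (q x).@[z] = \prod_(y <- s | y != x) (l x y).@[z].
  exact: rmorph_prod.
have qx (x : {ffun 'I_n -> K}) : (q x).@[x] != 0.
  rewrite qE prodf_seq_neq0; apply/allP => y _; apply/implyP => yx.
  by apply: lx; rewrite eq_sym.
have qy (x y : {ffun 'I_n -> K}) : y \in s -> y != x -> (q x).@[y] = 0.
  move=> ys yx; rewrite qE; apply/eqP; rewrite prodf_seq_eq0; apply/hasP.
  by exists y => //; rewrite yx ly ?eqxx // eq_sym.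
pose t := \sum_(x <- s) ((index x s)%:R / (q x).@[x]) *: q x.
suff tE (x : {ffun 'I_n -> K}) : x \in s -> t.@[x] = (index x s)%:R.
  exists t => x y xs ys /=; rewrite !tE // => /eqP; rewrite eqr_nat => /eqP.
  exact: (index_inj x).
move=> xs; rewrite raddf_sum (bigD1_seq x) //= big1_seq => [|y /andP[yx ys]].
  by rewrite mevalZ divfK // addr0.
have xy : x != y by rewrite eq_sym.
by rewrite /= mevalZ (qy _ _ xs xy) mulr0.
Qed.

(** * Common eigenvectors in stable subspaces *)

Section CommonEigenvector.
Variables (K : numClosedFieldType) (n N : nat) (A : 'I_n -> 'M[K]_N.+1).
Hypothesis AC : forall i j, GRing.comm (A i) (A j).

Lemma stable_common_eigenvector (W : 'M[K]_N.+1) :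
    (forall i, stablemx W (A i)) -> W != 0 ->
  exists (w : 'rV_N.+1) (x : {ffun 'I_n -> K}),
    [/\ w != 0, (w <= W)%MS & forall i, w *m A i = x i *: w].
Proof.
move=> WA W0; pose As := [seq restrictmx W (A i) | i <- enum 'I_n].
have [||v v0 /allP vA] := @common_eigenvector K _ As.
- by rewrite lt0n mxrank_eq0.
- move=> _ _ /mapP[i _ ->] /mapP[j _ ->].
  rewrite /comm_mx -!conjmxM ?inE ?stablemx_row_base //.
  by congr (conjmx _ _); exact: AC.
have vW : (v *m row_base W <= W)%MS by rewrite mulmx_sub // eq_row_base.
have [x xP] : exists x : 'I_n -> K, forall i,
    v *m row_base W *m A i = x i *: (v *m row_base W).
  apply: (fin_all_exists (P := fun i a =>
    v *m row_base W *m A i = a *: (v *m row_base W))) => i.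
  have : stablemx (v *m row_base W) (A i).
    rewrite -stablemx_restrict //; apply: vA; apply/mapP.
    by exists i; rewrite ?mem_enum.
  by case/eigenvectorP => a /eigenspaceP aE; exists a.
exists (v *m row_base W), [ffun i => x i]; split=> // [|i].
  by rewrite mulmx_free_eq0 ?row_base_free.
by rewrite ffunE.
Qed.

End CommonEigenvector.

(** * Counting the solutions from a multiplication table *)

Section SolutionCount.
Variables (K : numClosedFieldType) (n N m : nat) (A : 'I_n -> 'M[K]_N.+1).
Variables (P : 'I_m -> {mpoly K[n]}) (D : {mpoly K[n]}).
Variables (F : 'I_m -> {fraction {mpoly K[n]}}).
Variables (u : 'I_N.+1 -> {mpoly K[n]}) (v : 'rV[K]_N.+1).
Hypothesis AC : forall i j, GRing.comm (A i) (A j).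
Hypothesis AP : forall j, mxeval A (P j) = 0.
Hypothesis AD : mxeval A D \in unitmx.
Hypothesis vu : forall k, v *m mxeval A (u k) = delta_mx 0 k.
Hypothesis uA : forall p : 'I_n -> K, D.@[p] != 0 -> forall i k,
  local_ideal P p ('X_i * u k - \sum_l A i k l *: u l).
Hypothesis u_neq0 : forall p : 'I_n -> K,
  D.@[p] != 0 -> exists k, (u k).@[p] != 0.
Hypothesis FE : forall j, F j = tofrac (P j) / tofrac D.

Definition solution (x : {ffun 'I_n -> K}) :=
  [forall j, (P j).@[x] == 0] && (D.@[x] != 0).

Lemma solutionP (x : {ffun 'I_n -> K}) :
  reflect ((forall j, (P j).@[x] = 0) /\ D.@[x] != 0) (solution x).
Proof.
by apply: (iffP andP) => -[Px Dx]; split=> //; [move=> j; apply/eqP/(forallP Px)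
  | apply/forallP => j; rewrite Px].
Qed.

(** Each [P j] acts on [w] both by 0 and by its value at [x], while the invertible [D] cannot act on
    [w] by 0. *)
Lemma eigen_solution (w : 'rV_N.+1) (x : {ffun 'I_n -> K}) :
  w != 0 -> (forall i, w *m A i = x i *: w) -> solution x.
Proof.
move=> w0 wA; apply/solutionP; split=> [j|].
  have := mxeval_eigen AC (P j) wA; rewrite AP mulmx0 => /esym/eqP.
  by rewrite scaler_eq0 (negPf w0) orbF => /eqP.
apply: contraNneq w0 => Dx; have := mxeval_eigen AC D wA.
by rewrite Dx scale0r => /(canRL (mulmxK AD)); rewrite mul0mx => ->.
Qed.

(** Evaluating the multiplication table at [x] makes the vector of values of the [u k], nonzero by
    [u_neq0], a column eigenvector of [A i]; hence the transpose. *)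
Lemma solution_root (x : {ffun 'I_n -> K}) i :
  solution x -> root (char_poly (A i)^T) (x i).
Proof.
case/solutionP => Px Dx; rewrite -eigenvalue_root_char; apply/eigenvalueP.
exists (\row_k (u k).@[x]).
  apply/rowP => k; rewrite !mxE; have := local_ideal_eval Px (uA Dx i k).
  rewrite mevalB mevalM mevalXU (raddf_sum (meval x)) => /eqP.
  rewrite subr_eq0 => /eqP->.
  by apply: eq_bigr => l _; rewrite !mxE /= mevalZ mulrC.
have [k uk] := u_neq0 Dx; apply: contraNneq uk => /rowP/(_ k).
by rewrite !mxE => ->.
Qed.

(** All coordinates of solutions are roots of finitely many characteristic polynomials, so the
    solutions lie in a finite grid. *)
Lemma solutions_finite :
  exists2 s : seq {ffun 'I_n -> K}, uniq s & forall x, (x \in s) = solution x.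
Proof.
pose r i := sval (closed_field_poly_normal (char_poly (A i)^T)).
pose rs := flatten [seq r i | i <- enum 'I_n].
pose pts := [seq [ffun i => rs`_(f i)] | f : {ffun 'I_n -> 'I_(size rs)}].
exists (undup [seq x <- pts | solution x]) => [|x]; first exact: undup_uniq.
rewrite mem_undup mem_filter andbC; apply: andb_idl => xS.
have xr i : x i \in rs.
  apply/flattenP; exists (r i); first by rewrite map_f // mem_enum.
  have := solution_root i xS; rewrite /r.
  case: closed_field_poly_normal => l /= lE.
  rewrite lE rootZ ?root_prod_XsubC //.
  by rewrite lead_coef_eq0 monic_neq0 // char_poly_monic.
have xi i : (index (x i) rs < size rs)%N by rewrite index_mem.
apply/mapP; exists [ffun i => Ordinal (xi i)]; first by rewrite mem_enum.
by apply/ffunP => i; rewrite !ffunE nth_index.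
Qed.

(** * Splitting the space by a separating polynomial *)

Section Separated.
Variables (s : seq {ffun 'I_n -> K}) (t : {mpoly K[n]}).
Hypothesis s_uniq : uniq s.
Hypothesis sP : forall x, (x \in s) = solution x.
Hypothesis t_inj : {in s &, injective (fun x : {ffun 'I_n -> K} => t.@[x])}.

Let T := mxeval A t.
Let W (x : {ffun 'I_n -> K}) := geigenspace T t.@[x].

Let mxeval_commX f i : comm_mx (mxeval A f) (A i).
Proof. by rewrite -(mxevalX A i); apply: mxeval_comm. Qed.

Let stable_geigen x i : stablemx (W x) (A i).
Proof. exact/comm_mx_stable_geigenspace/mxeval_commX. Qed.

(** The eigenspace is stable under the [A i], so it contains a common eigenvector, whose eigenvalues
    form a solution. *)
Let eigenvalue_T a : eigenvalue T a -> exists2 x, x \in s & a = t.@[x].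
Proof.
move=> Ta.
have [||w [x [w0 wT wA]]] := stable_common_eigenvector AC (W := eigenspace T a).
- by move=> i; apply/comm_mx_stable_eigenspace/mxeval_commX.
- by [].
exists x; first by rewrite sP; apply: eigen_solution wA.
have := mxeval_eigen AC t wA; rewrite (eigenspaceP wT).
move/eqP; rewrite -subr_eq0 -scalerBl scaler_eq0 (negPf w0) orbF subr_eq0.
by move/eqP.
Qed.

Let factor (i : 'I_(size s)) : {poly K} :=
  ('X - (t.@[tnth (in_tuple s) i])%:P) ^+ N.+1.

Let t_tnth_inj : injective (fun i => t.@[tnth (in_tuple s) i]).
Proof.
move=> i j /t_inj e; apply/(tuple_uniqP (in_tuple s)) => //.
by apply: e; apply: mem_tnth.
Qed.

(** The minimal polynomial has at most [N.+1] roots with multiplicity, all of them values of [t] on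
    [s], so the exponent [N.+1] on each linear factor suffices. *)
Let mxminpoly_dvd : mxminpoly T %| \prod_i factor i.
Proof.
have [r rE] := closed_field_poly_normal (mxminpoly T).
move: rE; rewrite (monicP (mxminpoly_monic T)) scale1r => rE.
have szr : (size r <= N.+1)%N.
  have := dvdp_leq (monic_neq0 (char_poly_monic T)) (mxminpoly_dvd_char T).
  by rewrite size_char_poly {1}rE size_prod_XsubC.
rewrite prodrXl; set Q := \prod_i _.
have rQ : all (fun z => 'X - z%:P %| Q) r.
  apply/allP => z zr; have /eigenvalue_T[x xs ->] : eigenvalue T z.
    by rewrite eigenvalue_root_min rE root_prod_XsubC.
  have /tnthP[i ->] : x \in in_tuple s by [].
  by rewrite /Q (bigD1 i) //= dvdp_mulr.
apply: (@dvdp_trans _ (Q ^+ size r)); last exact: dvdp_exp2l.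
rewrite rE; elim: r rQ {rE szr} => [|z r IH] /=; first by rewrite big_nil dvd1p.
by case/andP => zQ /IH rQ; rewrite big_cons exprS dvdp_mul.
Qed.

Let factor_coprime i j : j != i -> coprimep (factor i) (factor j).
Proof.
move=> ji; rewrite coprimep_expr ?coprimep_expl // coprimep_XsubC.
by rewrite root_XsubC (inj_eq t_tnth_inj).
Qed.

(** The values of [t] on [s] are distinct, so the sum is direct; it is the kernel of a polynomial
    that annihilates [T], hence the whole space. *)
Lemma sum_rank_geigenspace :
  (\sum_(x <- s) \rank (W x) = N.+1)%N.
Proof.
rewrite big_tnth /=.
have := mxdirect_sum_geigenspace T (P := predT) (in2W t_tnth_inj).
move/mxdirectP => /= <-.
have co : {in predT &, forall i j, j != i -> coprimep (factor i) (factor j)}.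
  by move=> i j _ _; apply: factor_coprime.
rewrite -(eqmx_rank (introT eqmxP (kermxpoly_prod T co))).
by rewrite (eqmx_rank (introT eqmxP (kermxpoly_min mxminpoly_dvd))) mxrank1.
Qed.

Lemma has_multiplicity_geigenspace (x : {ffun 'I_n -> K}) : x \in s ->
  has_multiplicity x F (\rank (W x)).
Proof.
move=> xs; have := xs; rewrite sP => /solutionP[Px Dx].
have [i xE] : exists i, x = tnth (in_tuple s) i.
  exact/tnthP.
have /Bezout_eq1_coprimepP[[a b] /= ab1] :
    coprimep (factor i) (\prod_(j | j != i) factor j).
  elim/big_ind: _ => [|f g cf cg|j ji]; first exact: coprimep1.
    by rewrite coprimepMr cf.
  exact: factor_coprime.
(* [Q] is 1 modulo [factor i] and 0 modulo the other factors, so [Q] at [T] is the projection onto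
   [W x]; [q] is [Q] at [t]. *)
pose Q := b * \prod_(j | j != i) factor j.
pose q : {mpoly K[n]} := (map_poly (@mpolyC n K) Q).[t].
have FQ : horner_mx T (factor i * Q) = 0.
  have -> : factor i * Q = b * \prod_j factor j.
    by rewrite [\prod_j _](bigD1 i) //= /Q mulrCA.
  apply/mxminpoly_minP/dvdp_mull/mxminpoly_dvd.
apply: (has_multiplicity_rank AC AP vu (uA Dx) (u_neq0 Dx) _ _ _ _ _ FE Dx
  (q := q)).
- exact: stable_geigen.
(* If [h] killed a nonzero vector of [W x], the stable space of such vectors would contain a common
   eigenvector, giving a solution [y]. As [t] takes the same value at [y] and [x], [y = x], so [h]
   would vanish at [x]. *)
- move=> h w hx wW wh; apply/eqP/negPn/negP => w0.
  have [||w' [y [w'0]]] := stable_common_eigenvector AC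
    (W := (W x :&: kermx (mxeval A h))%MS).
  + move=> k; rewrite sub_capmx.
    rewrite (submx_trans (submxMr _ (capmxSl _ _)) (stable_geigen _ _)) //=.
    apply: (submx_trans (submxMr _ (capmxSr _ _))).
    exact/comm_mx_stable_ker/mxeval_commX.
  + apply: contraNneq w0 => c0; rewrite -submx0 -c0 sub_capmx wW.
    exact/sub_kermxP.
  rewrite sub_capmx => /andP[w'W /sub_kermxP w'h] w'A.
  have ys : y \in s by rewrite sP; apply: eigen_solution w'A.
  have yx : y = x.
    apply: t_inj => //; apply/eqP; rewrite -subr_eq0.
    move/sub_kermxP: w'W; rewrite -/T.
    have <- : mxeval A ((t - (t.@[x])%:MP) ^+ N.+1)
            = horner_mx T (('X - (t.@[x])%:P) ^+ N.+1).
      rewrite !rmorphXn /= !rmorphB /= horner_mx_X horner_mx_C.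
      by rewrite mxevalC.
    rewrite (mxeval_eigen AC _ w'A) rmorphXn rmorphB /= mevalC => /eqP.
    by rewrite scaler_eq0 (negPf w'0) orbF expf_eq0.
  move: w'h; rewrite (mxeval_eigen AC h w'A) yx => /eqP.
  by rewrite scaler_eq0 (negPf w'0) (negPf hx).
- have := congr1 (horner^~ t.@[x]) ab1; rewrite meval_horner /Q /factor -xE.
  by rewrite !hornerE /= subrr expr0n mulr0 add0r => ->; apply: oner_neq0.
- apply/sub_kermxP; rewrite -mulmxA mxeval_horner // mulmxE -rmorphM /=.
  by rewrite mulrC xE FQ mulmx0.
- have -> : (1 - q) * q = (map_poly (@mpolyC n K) (a * (factor i * Q))).[t].
    rewrite mulrA (_ : a * factor i = 1 - Q); last by rewrite -ab1 addrK.
    by rewrite rmorphM rmorphB rmorph1 /= hornerM hornerD hornerN hornerC.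
  by rewrite mxeval_horner // rmorphM /= FQ mulr0.
Qed.

End Separated.

Theorem solution_count :
  exists (s : seq {ffun 'I_n -> K}) (mu : {ffun 'I_n -> K} -> nat),
    [/\ uniq s, forall x, (x \in s) = solution x,
        forall x, x \in s -> has_multiplicity x F (mu x)
      & (\sum_(x <- s) mu x)%N = N.+1].
Proof.
have [s s_uniq sP] := solutions_finite.
have [t t_inj] := separating_mpoly s_uniq.
exists s, (fun x => \rank (geigenspace (mxeval A t) t.@[x])); split=> //.
  by move=> x; apply: has_multiplicity_geigenspace.
exact: sum_rank_geigenspace.
Qed.

End SolutionCount.

(** * The multiplication table of the torus algebra *)

Lemma I3P (Q : 'I_3 -> Prop) : Q 0 -> Q 1 -> Q 2 -> forall i, Q i.
Proof.
move=> Q0 Q1 Q2 [[|[|[|//]]] h].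
- by rewrite (_ : Ordinal h = 0) //; apply/val_inj.
- by rewrite (_ : Ordinal h = 1) //; apply/val_inj.
- by rewrite (_ : Ordinal h = 2) //; apply/val_inj.
Qed.

Lemma I4P (Q : 'I_4 -> Prop) : Q 0 -> Q 1 -> Q 2 -> Q 3 -> forall i, Q i.
Proof.
move=> Q0 Q1 Q2 Q3 [[|[|[|[|//]]]] h].
- by rewrite (_ : Ordinal h = 0) //; apply/val_inj.
- by rewrite (_ : Ordinal h = 1) //; apply/val_inj.
- by rewrite (_ : Ordinal h = 2) //; apply/val_inj.
- by rewrite (_ : Ordinal h = 3) //; apply/val_inj.
Qed.

Lemma add_I3 :
  (0 + 0 = 0 :> 'I_3)%R * (1 + 0 = 1 :> 'I_3)%R * (2 + 0 = 2 :> 'I_3)%R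
  * (0 + 1 = 1 :> 'I_3)%R * (1 + 1 = 2 :> 'I_3)%R * (2 + 1 = 0 :> 'I_3)%R
  * (0 + 2 = 2 :> 'I_3)%R * (1 + 2 = 0 :> 'I_3)%R * (2 + 2 = 1 :> 'I_3)%R
  * (- 0 = 0 :> 'I_3)%R * (- 1 = 2 :> 'I_3)%R * (- 2 = 1 :> 'I_3)%R.
Proof. by do ! split; apply/val_inj. Qed.

Lemma third_I3 (i : 'I_3) :
  (- (i + (i + 1)) = i + 2)%R * (- (i + (i + 2)) = i + 1)%R
  * (- (i + 1 + (i + 2)) = i)%R
  * ((i == i + 1) = false)%R * ((i == i + 2) = false)%R
  * ((i + 1 == i + 2) = false)%R.
Proof. by elim/I3P: i; do ! split; apply/val_inj. Qed.

Lemma shift_I3 (i : 'I_3) :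
  (i + 1 + 1 = i + 2)%R * (i + 1 + 2 = i)%R
  * (i + 2 + 1 = i)%R * (i + 2 + 2 = i + 1)%R.
Proof. by elim/I3P: i; do ! split; apply/val_inj. Qed.

Lemma I3_cases (i j : 'I_3) : [\/ j = i, j = i + 1 | j = i + 2].
Proof.
have : [|| j == i, j == i + 1 | j == i + 2] by elim/I3P: i; elim/I3P: j.
by case/or3P => /eqP->; [apply: Or31 | apply: Or32 | apply: Or33].
Qed.

Definition emb (j : 'I_3) : 'I_4 := widen_ord (isT : 3 <= 4)%N j.

Lemma embE : (emb 0 = 0) * (emb 1 = 1) * (emb 2 = 2).
Proof. by do ! split; apply/val_inj. Qed.

Lemma sumI3 (V : nmodType) (f : 'I_3 -> V) : \sum_i f i = f 0 + f 1 + f 2.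
Proof.
rewrite !big_ord_recl big_ord0 addr0 addrA.
by congr (_ + f _ + f _); apply/val_inj.
Qed.

Lemma sumI3_cyc (V : nmodType) (f : 'I_3 -> V) i :
  \sum_j f j = f i + f (i + 1) + f (i + 2).
Proof.
rewrite sumI3; elim/I3P: i; rewrite !add_I3 //.
  by rewrite -addrA addrC.
by rewrite addrC addrA.
Qed.

Lemma sumI4 (V : nmodType) (f : 'I_4 -> V) :
  \sum_i f i = f 0 + f 1 + f 2 + f 3.
Proof.
rewrite !big_ord_recl big_ord0 addr0 !addrA.
by congr (_ + f _ + f _ + f _); apply/val_inj.
Qed.

Section TorusAlgebra.
Variables (K : fieldType) (c : 'I_3 -> 'I_3 -> K).
Hypothesis c_diag : forall i, c i i != 0.

(* Coordinates in the basis x_0, x_1, x_2, x_0 x_1 x_2 of the torus algebra of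
   the quadrics x_(i+1) x_(i+2) = l_i(x), l_i := \sum_j c i j x_j; indices are
   taken in 'I_3, the ring of integers mod 3, so that i, j, - (i + j) exhaust
   'I_3 when i != j. *)
Definition lin_coord (i : 'I_3) (k : nat) : K :=
  nth 0 [:: c i 0; c i 1; c i 2; 0] k.

(* From x_0 x_1 x_2 = x_i l_i, where only the x_i^2 term is unknown. *)
Definition sqr_coord (i : 'I_3) (k : nat) : K :=
  (c i i)^-1 * ((k == 3%N)%:R - c i (i + 1) * lin_coord (i + 2) k
                              - c i (i + 2) * lin_coord (i + 1) k).

Definition prod_coord (i j : 'I_3) (k : nat) : K :=
  if i == j then sqr_coord i k else lin_coord (- (i + j)) k.

(* From x_i (x_0 x_1 x_2) = (x_i x_(i+1)) (x_i x_(i+2)) = l_(i+2) l_(i+1). *)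
Definition cubic_coord (i : 'I_3) (k : nat) : K :=
  \sum_j \sum_l c (i + 1) j * c (i + 2) l * prod_coord j l k.

Definition mulX_mx (i : 'I_3) : 'M[K]_4 :=
  \matrix_(k, l)
    nth 0 [:: prod_coord i 0 l; prod_coord i 1 l; prod_coord i 2 l;
              cubic_coord i l] k.


Lemma mulX_mx_prod i j l : mulX_mx i (emb j) l = prod_coord i j l.
Proof. by elim/I3P: j; rewrite mxE embE. Qed.

Lemma mulX_mx_cubic i l : mulX_mx i 3 l = cubic_coord i l.
Proof. by rewrite mxE. Qed.

Lemma prod_coordC i j l : prod_coord i j l = prod_coord j i l.
Proof. by rewrite /prod_coord [j == i]eq_sym addrC; case: eqP => // ->. Qed.

Lemma prod_coord_lin i j l :
  i != j -> prod_coord i j l = lin_coord (- (i + j)) l.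
Proof. by rewrite /prod_coord => /negPf->. Qed.

Lemma sum_prod_coord i k : \sum_j c i j * prod_coord i j k = (k == 3%N)%:R.
Proof.
rewrite (sumI3_cyc _ i) (prod_coord_lin (j := i + 1)) ?third_I3 //.
rewrite (prod_coord_lin (j := i + 2)) ?third_I3 //.
rewrite /prod_coord eqxx /sqr_coord mulVKf //; ring.
Qed.

Lemma sum_lin_coord (V : lmodType K) (f : 'I_4 -> V) i :
  \sum_(k < 4) lin_coord i k *: f k = \sum_j c i j *: f (emb j).
Proof. by rewrite sumI4 sumI3 !embE /= scale0r addr0. Qed.

Lemma sum_sqr_coord (V : lmodType K) (f : 'I_4 -> V) i :
  \sum_(k < 4) prod_coord i i k *: f k
    = (c i i)^-1 *: (f 3 - c i (i + 1) *: (\sum_j c (i + 2) j *: f (emb j))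
                         - c i (i + 2) *: (\sum_j c (i + 1) j *: f (emb j))).
Proof.
rewrite /prod_coord eqxx -!sum_lin_coord.
under eq_bigr do rewrite /sqr_coord -scalerA.
rewrite -scaler_sumr; congr (_ *: _).
under eq_bigr do rewrite !scalerBl -!scalerA.
rewrite !sumrB -!scaler_sumr; congr (_ - _ - _).
by rewrite sumI4 /= !scale0r scale1r !add0r.
Qed.

(** Expanded forms of [sqr_coord] and [cubic_coord] with the cyclic triple of indices spelled out,
    reducing matrix identities to field identities. *)
Let sq (i j k : 'I_3) (l : nat) :=
  (c i i)^-1 * ((l == 3%N)%:R - c i j * lin_coord k l - c i k * lin_coord j l).

Let cb (i j k : 'I_3) (l : nat) :=
  c j i * c k i * sq i j k l + c j j * c k j * sq j k i l
  + c j k * c k k * sq k i j l + (c j i * c k j + c j j * c k i) * lin_coord k l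
  + (c j j * c k k + c j k * c k j) * lin_coord i l
  + (c j k * c k i + c j i * c k k) * lin_coord j l.

Let mulX_mxE :
  (mulX_mx 0 = \matrix_(k, l)
     nth 0 [:: sq 0 1 2 l; lin_coord 2 l; lin_coord 1 l; cb 0 1 2 l] k)
  * (mulX_mx 1 = \matrix_(k, l)
       nth 0 [:: lin_coord 2 l; sq 1 2 0 l; lin_coord 0 l; cb 1 2 0 l] k)
  * (mulX_mx 2 = \matrix_(k, l)
       nth 0 [:: lin_coord 1 l; lin_coord 0 l; sq 2 0 1 l; cb 2 0 1 l] k).
Proof.
split; first split; apply/matrixP => k l; rewrite !mxE;
  rewrite /prod_coord /sqr_coord /= !add_I3 /=; congr (nth 0 [:: _; _; _; _] k);
  rewrite /cubic_coord !sumI3 /prod_coord /= /sqr_coord /= !add_I3;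
  rewrite /cb /sq; ring.
Qed.

(** The matrices satisfy the quadrics, as an entrywise computation shows. Commutativity follows,
    since the right-hand side is symmetric in [i] and [k]. *)
Lemma mulX_mxM i k : i != k ->
  mulX_mx i *m mulX_mx k = \sum_j c (- (i + k)) j *: mulX_mx j.
Proof.
have c0 := c_diag 0; have c1 := c_diag 1; have c2 := c_diag 2.
move: i k; apply: I3P; apply: I3P => //= _; rewrite sumI3 !add_I3 !mulX_mxE.
all: apply/matrixP; apply: I4P; apply: I4P; rewrite !mxE sumI4 !mxE /=.
all: rewrite /cb /sq /lin_coord /=; field; by rewrite ?c0 ?c1 ?c2.
Qed.

Lemma mulX_mx_comm i j : GRing.comm (mulX_mx i) (mulX_mx j).
Proof.
have [->//|ij] := eqVneq i j.
have ji : j != i by rewrite eq_sym.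
by rewrite /GRing.comm -!mulmxE (mulX_mxM ij) (mulX_mxM ji) addrC.
Qed.

End TorusAlgebra.

(** * Invertibility of the coordinates and the local multiplication table *)

Section TorusAlgebraPoints.
Variables (K : numClosedFieldType) (c : 'I_3 -> 'I_3 -> K).
Hypothesis c_diag : forall i, c i i != 0.
Hypothesis c_minor : forall i,
  c (i + 1) (i + 1) * c (i + 2) (i + 2) - c (i + 1) (i + 2) * c (i + 2) (i + 1)
    != 0.
Hypothesis c_inj : forall y : 'I_3 -> K,
  (forall i, \sum_j c i j * y j = 0) -> forall i, y i = 0.

Local Notation A := (mulX_mx c).

Lemma right_eigenvalues (y : 'cV[K]_4) (x : 'I_3 -> K) :
    y != 0 -> (forall i, A i *m y = x i *: y) ->
  forall i k, i != k -> x i * x k = \sum_j c (- (i + k)) j * x j.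
Proof.
move=> y0 Ay i k ik; apply/eqP; rewrite -subr_eq0.
suff /eqP: (x i * x k - \sum_j c (- (i + k)) j * x j) *: y = 0.
  by rewrite scaler_eq0 (negPf y0) orbF.
have := congr1 (mulmx^~ y) (mulX_mxM c_diag ik); rewrite -mulmxA Ay.
rewrite -scalemxAr Ay scalerA mulmx_suml mulrC => e.
rewrite scalerBl e scaler_suml; apply/eqP; rewrite subr_eq0; apply/eqP.
by apply: eq_bigr => j _; rewrite -scalemxAl Ay scalerA.
Qed.

(* If x i = 0 then the quadrics and the minors force x = 0, so every A j kills
   y; the rows of the A j span, hence y = 0. *)
Lemma right_eigenvalue_neq0 (y : 'cV[K]_4) (x : 'I_3 -> K) i :
  y != 0 -> (forall i, A i *m y = x i *: y) -> x i != 0.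
Proof.
move=> y0 Ay; apply: contraNneq (y0) => xi0.
have xx := right_eigenvalues y0 Ay.
have x0 : forall j, x j = 0.
  have {}xx k (ik : i != k) : c (- (i + k)) (i + 1) * x (i + 1)
      + c (- (i + k)) (i + 2) * x (i + 2) = 0.
    have := xx i k ik; rewrite (sumI3_cyc _ i) xi0 mul0r mulr0 add0r.
    by move/esym.
  have := xx (i + 1); rewrite !third_I3 => /(_ isT) e1.
  have := xx (i + 2); rewrite !third_I3 => /(_ isT) e2.
  (* [e1] and [e2] are a homogeneous 2x2 system in the other two coordinates with determinant
     nonzero by [c_minor i]; Cramer's rule applies. *)
  have x1 : x (i + 1) = 0.
    apply: (mulfI (c_minor i)); rewrite mulr0.
    transitivity
      (c (i + 2) (i + 2) * (c (i + 1) (i + 1) * x (i + 1)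
                            + c (i + 1) (i + 2) * x (i + 2))
       - c (i + 1) (i + 2) * (c (i + 2) (i + 1) * x (i + 1)
                              + c (i + 2) (i + 2) * x (i + 2))).
      ring.
    by rewrite e1 e2 !mulr0 subrr.
  have x2 : x (i + 2) = 0.
    apply: (mulfI (c_minor i)); rewrite mulr0.
    transitivity
      (c (i + 1) (i + 1) * (c (i + 2) (i + 1) * x (i + 1)
                            + c (i + 2) (i + 2) * x (i + 2))
       - c (i + 2) (i + 1) * (c (i + 1) (i + 1) * x (i + 1)
                              + c (i + 1) (i + 2) * x (i + 2))).
      ring.
    by rewrite e1 e2 !mulr0 subrr.
  by move=> j; case: (I3_cases i j) => ->.
have Ay0 k l : \sum_s A k l s * y s 0 = 0.
  by have := congr1 (fun M : 'cV_4 => M l 0) (Ay k); rewrite x0 scale0r !mxE.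
(* Since [x_(m+1) x_(m+2) = l_m], row [emb (m + 2)] of [A (m + 1)] holds the coefficients of
   [l_m]. *)
have y012 : forall j : 'I_3, y (emb j) 0 = 0.
  apply: c_inj => m; rewrite -[RHS](Ay0 (m + 1) (emb (m + 2))).
  transitivity (\sum_(k < 4) lin_coord c m k * y k 0).
    exact: (esym (sum_lin_coord c (fun k => y k 0 : K^o) m)).
  apply: eq_bigr => k _.
  by rewrite mulX_mx_prod prod_coord_lin third_I3.
have lin0 i' : \sum_j c i' j *: (y (emb j) 0 : K^o) = 0.
  by rewrite big1 // => j _; rewrite y012 scaler0.
(* In the row of [x_0^2], the coefficient of [x_0 x_1 x_2] is the nonzero [(c 0 0)^-1]. *)
have y3 : y 3 0 = 0.
  have := Ay0 0 (emb 0); under eq_bigr do rewrite mulX_mx_prod.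
  rewrite (sum_sqr_coord c (fun k => y k 0 : K^o)) !lin0 !scaler0 !subr0 => e.
  by apply: (mulfI (invr_neq0 (c_diag 0))); rewrite mulr0; apply: e.
apply/eqP/colP; apply: I4P; rewrite mxE //.
- by rewrite -(y012 0) embE.
- by rewrite -(y012 1) embE.
- by rewrite -(y012 2) embE.
Qed.

(** If [A i] were singular, the kernel of its transpose would contain a common eigenvector of all
    the transposes with [x i = 0]. Transposed, it is a column eigenvector excluded by
    [right_eigenvalue_neq0]. *)
Lemma mulX_mx_unit i : A i \in unitmx.
Proof.
rewrite -unitmx_tr -row_free_unit -kermx_eq0; apply/negP => /negP ker0.
have BC j k : GRing.comm (A j)^T (A k)^T.
  by rewrite /GRing.comm -!mulmxE -!trmx_mul !mulmxE (mulX_mx_comm c_diag).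
have [||w [x [w0 wi wB]]] :=
  stable_common_eigenvector BC (W := kermx (A i)^T).
- by move=> j; apply: comm_mx_stable_ker; apply: BC.
- by [].
have yA j : A j *m w^T = x j *: w^T.
  by rewrite -[A j]trmxK -trmx_mul wB linearZ.
have y0 : w^T != 0 by rewrite trmx_eq0.
have := right_eigenvalue_neq0 i y0 yA.
move/sub_kermxP: wi; rewrite wB => /eqP.
by rewrite scaler_eq0 (negPf w0) orbF => ->.
Qed.

(** The coordinates of 1, obtained as [x_0 / x_0]. *)
Definition torus_one : 'rV[K]_4 := delta_mx 0 0 *m invmx (A 0).

Definition torus_basis (k : 'I_4) : {mpoly K[3]} :=
  nth 0 [:: 'X_0; 'X_1; 'X_2; 'X_0 * 'X_1 * 'X_2] k.

(** Once the inverse is moved across, this is [x_0 x_i = x_i x_0], the symmetry of [prod_coord]. *)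
Lemma torus_one_mulX i : torus_one *m A i = delta_mx 0 (emb i).
Proof.
have AC : invmx (A 0) *m A i = A i *m invmx (A 0).
  apply: (canRL (mulmxK (mulX_mx_unit 0))); rewrite -mulmxA mulmxE.
  by rewrite (mulX_mx_comm c_diag) -mulmxE mulKmx // mulX_mx_unit.
rewrite -mulmxA AC mulmxA; apply: (canLR (mulmxK (mulX_mx_unit 0))).
apply/rowP => l; rewrite -!rowE.
transitivity (A i (emb 0) l); first by rewrite embE [LHS]mxE.
by rewrite mulX_mx_prod prod_coordC -mulX_mx_prod [RHS]mxE.
Qed.

Lemma torus_one_basis k : torus_one *m mxeval A (torus_basis k) = delta_mx 0 k.
Proof.
have AC := mulX_mx_comm c_diag.
elim/I4P: k; rewrite /torus_basis /= ?mxevalX ?torus_one_mulX ?embE //.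
(* For the last basis element, [x_0 (x_1 x_2) = x_0 l_0], which [sum_prod_coord] identifies with the
   fourth unit vector. *)
rewrite !mxevalM // !mxevalX !mulmxA torus_one_mulX -mulmxA.
rewrite (mulX_mxM c_diag) // -rowE; apply/rowP => l.
rewrite !add_I3 [LHS]mxE summxE [RHS]mxE /= -(sum_prod_coord c_diag 0).
apply: eq_bigr => j _; rewrite [LHS]mxE prod_coordC -mulX_mx_prod embE //.
Qed.

Section LocalCongruence.
Variables (m : nat) (P : 'I_m -> {mpoly K[3]}) (p : 'I_3 -> K).
Let X (i : 'I_3) : {mpoly K[3]} := 'X_i.
Let l i : {mpoly K[3]} := \sum_j c i j *: 'X_j.
Hypothesis P_quadric : forall i, local_ideal P p (X (i + 1) * X (i + 2) - l i).

Let basis_emb j : torus_basis (emb j) = X j.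
Proof. by elim/I3P: j; rewrite embE. Qed.

Let basis3 i : torus_basis 3 = X i * X (i + 1) * X (i + 2).
Proof. by elim/I3P: i; rewrite !add_I3 /torus_basis /X /=; ring. Qed.

Let local_lin i j : i != j -> local_ideal P p (X i * X j - l (- (i + j))).
Proof.
case: (I3_cases i j) => ->; rewrite ?eqxx // third_I3 => _.
  have := P_quadric (i + 2).
  by elim/I3P: i; rewrite !add_I3.
rewrite [X i * _]mulrC; have := P_quadric (i + 1).
by elim/I3P: i; rewrite !add_I3.
Qed.

Let local_prd i j :
  local_ideal P p
    (X i * X j - \sum_(k < 4) prod_coord c i j k *: torus_basis k).
Proof.
have [<-|ij] := eqVneq i j; last first.
  under eq_bigr do rewrite prod_coord_lin //.
  rewrite sum_lin_coord; under eq_bigr do rewrite basis_emb; exact: local_lin.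
(* Multiplying by [c i i] clears the inverse in [sqr_coord]; the rest is [x_i l_i = x_0 x_1 x_2]
   with the mixed products replaced by linear forms. *)
have cii : ((c i i)%:MP_[3]).@[p] != 0 by rewrite mevalC.
apply: (local_ideal_cancel cii).
rewrite mulrBr [X in _ - X]mul_mpolyC sum_sqr_coord scalerA divff // scale1r.
under eq_bigr do rewrite basis_emb; rewrite -/(l _).
under eq_bigr do rewrite basis_emb; rewrite -/(l _) (basis3 i).
have lE : l i = (c i i)%:MP * X i + (c i (i + 1))%:MP * X (i + 1)
                + (c i (i + 2))%:MP * X (i + 2).
  by rewrite /l (sumI3_cyc _ i) !mul_mpolyC.
have h0 := P_quadric i.
have h1 := @local_lin i (i + 1); have h2 := @local_lin i (i + 2).
rewrite !third_I3 in h1 h2.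
rewrite -!mul_mpolyC (_ : _ - _ = - (X i * (X (i + 1) * X (i + 2) - l i)
   + (c i (i + 1))%:MP * (X i * X (i + 1) - l (i + 2))
   + (c i (i + 2))%:MP * (X i * X (i + 2) - l (i + 1)))); last first.
  by rewrite lE; ring.
apply: local_idealN; apply: local_idealD; last exact/local_idealMl/h2.
apply: local_idealD; apply: local_idealMl => //; exact: h1.
Qed.

Lemma local_mulX_mx i k :
  local_ideal P p ('X_i * torus_basis k - \sum_s A i k s *: torus_basis s).
Proof.
have embP j : local_ideal P p
    ('X_i * torus_basis (emb j) - \sum_s A i (emb j) s *: torus_basis s).
  by rewrite basis_emb; under eq_bigr do rewrite mulX_mx_prod; exact: local_prd.
elim/I4P: k; first by have := embP 0; rewrite embE.
- by have := embP 1; rewrite embE.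
- by have := embP 2; rewrite embE.
(* In the last row, [x_i (x_0 x_1 x_2)] is congruent to [l_(i+1) l_(i+2)], whose expansion into
   products [x_j x_t] is reduced by [local_prd]. *)
under eq_bigr do rewrite mulX_mx_cubic.
rewrite (_ : \sum_s _ = \sum_j \sum_t (c (i + 1) j * c (i + 2) t)
          *: \sum_(s < 4) prod_coord c j t s *: torus_basis s); last first.
  under [RHS]eq_bigr => j _.
    under eq_bigr => t _ do rewrite scaler_sumr.
    rewrite exchange_big; over.
  rewrite exchange_big; apply: eq_bigr => s _ /=.
  rewrite /cubic_coord scaler_suml; apply: eq_bigr => j _.
  by rewrite scaler_suml; apply: eq_bigr => t _; rewrite scalerA.
have h1 := @local_lin i (i + 1); have h2 := @local_lin i (i + 2).
rewrite !third_I3 in h1 h2.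
have llE : l (i + 1) * l (i + 2)
    = \sum_j \sum_t (c (i + 1) j * c (i + 2) t) *: (X j * X t).
  rewrite /l big_distrlr /=; apply: eq_bigr => j _; apply: eq_bigr => t _.
  by rewrite -scalerAl -scalerAr scalerA.
rewrite (basis3 i) -/(X i).
rewrite (_ : _ - _ = X i * X (i + 2) * (X i * X (i + 1) - l (i + 2))
   + l (i + 2) * (X i * X (i + 2) - l (i + 1))
   + (l (i + 1) * l (i + 2) - \sum_j \sum_t (c (i + 1) j * c (i + 2) t)
          *: \sum_(s < 4) prod_coord c j t s *: torus_basis s)); last by ring.
apply: local_idealD.
  by apply: local_idealD; apply: local_idealMl; [apply: h1 | apply: h2].
rewrite llE -sumrB; apply: local_ideal_sum => j.
rewrite -sumrB; apply: local_ideal_sum => t.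
by rewrite -scalerBr -mul_mpolyC; apply: local_idealMl.
Qed.

End LocalCongruence.

End TorusAlgebraPoints.

(** * The system *)

(** Equation [i] multiplied by [x_0 x_1 x_2], in cyclic notation; a general ring allows both scalars
    and polynomials. *)
Definition numerator (R : comNzRingType) (L : R) (a d x : 'I_3 -> R) i : R :=
  a i * (x (i + 1) * x (i + 2))
  + 2 * L * (x (i + 1) ^+ 2 + x (i + 2) ^+ 2 - x i ^+ 2)
  + 4 * d i * (x 0 * x 1 * x 2).

Lemma rmorph_Lprime (R S : comNzRingType) (f : {rmorphism R -> S}) b d :
  f (Lprime b d) = Lprime (f b) (f d).
Proof. by rewrite /Lprime rmorphN !rmorphM rmorph_nat. Qed.

Lemma rmorph_numerator (R S : comNzRingType) (f : {rmorphism R -> S})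
    L a d x i :
  f (numerator L a d x i) = numerator (f L) (fun j => f (a j))
    (fun j => f (d j)) (fun j => f (x j)) i.
Proof.
by rewrite /numerator 2!rmorphD !rmorphM !rmorph_nat rmorphB rmorphD !rmorphXn.
Qed.

Lemma lhs_numerator (K : fieldType) (L : K) (b d x : 'I_3 -> K) i :
    (forall j, x j != 0) ->
  lhs L b d x i
    = numerator L (fun j => Lprime (b j) (d j)) d x i / (x 0 * x 1 * x 2).
Proof.
move=> x0; have := x0 0; have := x0 1; have := x0 2.
elim/I3P: i; rewrite /lhs /numerator (tnth_nth 0) /= !add_I3;
  move=> x2 x1 {}x0; field; by rewrite x0 x1 x2.
Qed.

(** Row [i] is the linear form left after adding numerators [i + 1] and [i + 2] and dividing by
    [x_i]. Off the diagonal, [- (i + j)] is the third index. *)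
Definition quadric_mx (K : fieldType) (L : K) (b d : 'I_3 -> K) i j : K :=
  if i == j then 4 * L else Lprime (b (- (i + j))) (d (- (i + j))).

Section TorusSystem.
Variables (K : numClosedFieldType) (L : K) (b d : 'I_3 -> K).
Let a j := Lprime (b j) (d j).
Let e i := 4 * (d (i + 1) + d (i + 2)).
Local Notation quadric_mx := (quadric_mx L b d).
Hypothesis L_neq0 : L != 0.
Hypothesis d_neq0 : forall i, d (i + 1) + d (i + 2) != 0.
Hypothesis minor_neq0 : forall i, (4 * L) ^+ 2 - (Lprime (b i) (d i)) ^+ 2 != 0.
Hypothesis quadric_inj : forall y : 'I_3 -> K,
  (forall i, \sum_j quadric_mx i j * y j = 0) -> forall i, y i = 0.

Let c i j := - quadric_mx i j / e i.

Let e_neq0 i : e i != 0.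
Proof. by rewrite mulf_neq0 // pnatr_eq0. Qed.

Let c_diag i : c i i != 0.
Proof.
rewrite mulf_neq0 ?invr_eq0 // oppr_eq0 /quadric_mx eqxx.
by rewrite mulf_neq0 ?pnatr_eq0.
Qed.

Let ec i j : e i * c i j = - quadric_mx i j.
Proof. by rewrite mulrC divfK. Qed.

(** Clearing the row factors [e] leaves the 2x2 determinant attached to [i], the third index beside
    [i + 1] and [i + 2]. *)
Let c_minor i :
  c (i + 1) (i + 1) * c (i + 2) (i + 2) - c (i + 1) (i + 2) * c (i + 2) (i + 1)
    != 0.
Proof.
have e1 := e_neq0 (i + 1); have e2 := e_neq0 (i + 2).
suff : e (i + 1) * e (i + 2) *
  (c (i + 1) (i + 1) * c (i + 2) (i + 2)
   - c (i + 1) (i + 2) * c (i + 2) (i + 1)) != 0.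
  by apply: contraNneq => ->; rewrite mulr0.
rewrite (_ : _ * _ =
  (e (i + 1) * c (i + 1) (i + 1)) * (e (i + 2) * c (i + 2) (i + 2))
  - (e (i + 1) * c (i + 1) (i + 2)) * (e (i + 2) * c (i + 2) (i + 1)));
  last by ring.
rewrite !ec /quadric_mx !eqxx [i + 2 + _]addrC [i + 2 == _]eq_sym !third_I3.
rewrite (_ : _ - _ = (4 * L) ^+ 2 - (Lprime (b i) (d i)) ^+ 2) //; ring.
Qed.

Let c_inj (y : 'I_3 -> K) :
  (forall i, \sum_j c i j * y j = 0) -> forall i, y i = 0.
Proof.
move=> cy; apply: quadric_inj => i; apply: oppr_inj; rewrite oppr0.
transitivity (e i * \sum_j c i j * y j); last by rewrite cy mulr0.
rewrite mulr_sumr -sumrN; apply: eq_bigr => j _.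
by rewrite mulrA ec mulNr.
Qed.

Let X (i : 'I_3) : {mpoly K[3]} := 'X_i.
Let P i := numerator L%:MP (fun j => (a j)%:MP) (fun j => (d j)%:MP) X i.
Let D := X 0 * X 1 * X 2.
Let q i := X (i + 1) * X (i + 2) - \sum_j c i j *: 'X_j.

Let D_cyc i : D = X i * X (i + 1) * X (i + 2).
Proof. by rewrite /D; elim/I3P: i; rewrite !add_I3; ring. Qed.

(* Adding equations i+1 and i+2 isolates x_i / (x_(i+1) x_(i+2)). *)
Let P_quadric i : (e i)%:MP * (X i * q i) = P (i + 1) + P (i + 2).
Proof.
have eS : (e i)%:MP * (\sum_j c i j *: 'X_j)
    = - ((4 * L)%:MP * X i + (a (i + 2))%:MP * X (i + 1)
         + (a (i + 1))%:MP * X (i + 2)).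
  transitivity (- \sum_j (quadric_mx i j)%:MP * X j); last first.
    by rewrite (sumI3_cyc _ i) /quadric_mx eqxx !third_I3.
  rewrite mulr_sumr -sumrN; apply: eq_bigr => j _.
  by rewrite -mul_mpolyC mulrA -mpolyCM ec mpolyCN mulNr.
transitivity ((e i)%:MP * D - X i * ((e i)%:MP * (\sum_j c i j *: 'X_j))).
  by rewrite (D_cyc i) /q; ring.
rewrite eS /P /numerator !shift_I3 -/D /e !mpolyCM !mpolyC_nat mpolyCD; ring.
Qed.

(** Inverts the pairwise sums of [P_quadric]; as 2 is invertible, matrices that satisfy the quadrics
    also annihilate [P]. *)
Let P_double i : 2%:R%:MP * P i = (e (i + 1))%:MP * (X (i + 1) * q (i + 1))
  + (e (i + 2))%:MP * (X (i + 2) * q (i + 2)) - (e i)%:MP * (X i * q i).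
Proof.
rewrite !P_quadric !shift_I3 mpolyC_nat.
move: (P i) (P (i + 1)) (P (i + 2)) => p0 p1 p2; ring.
Qed.

Local Notation A := (mulX_mx c).

Let mxeval_q i : mxeval A (q i) = 0.
Proof.
have AC := mulX_mx_comm c_diag.
rewrite raddfB /= mxevalM // !mxevalX (mulX_mxM c_diag) ?third_I3 //.
rewrite mxeval_sum; apply/eqP; rewrite subr_eq0; apply/eqP.
by apply: eq_bigr => j _; rewrite mxevalZ mxevalX.
Qed.

Let mxeval_P i : mxeval A (P i) = 0.
Proof.
have AC := mulX_mx_comm c_diag.
have qX j : mxeval A ((e j)%:MP * (X j * q j)) = 0.
  by rewrite !mxevalM // mxeval_q !mulmx0.
have := congr1 (mxeval A) (P_double i).
rewrite (raddfB (mxeval A)) (raddfD (mxeval A)) /= !qX addr0 subr0.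
rewrite mxevalM // mxevalC mul_scalar_mx => /eqP.
by rewrite scaler_eq0 pnatr_eq0 => /eqP.
Qed.

Let mxeval_D : mxeval A D \in unitmx.
Proof.
have AC := mulX_mx_comm c_diag.
have Au := mulX_mx_unit c_diag c_minor c_inj.
by rewrite !mxevalM // !mxevalX !unitmx_mul !Au.
Qed.

Let meval_D (p : 'I_3 -> K) : D.@[p] = p 0 * p 1 * p 2.
Proof. by rewrite !mevalM !mevalXU. Qed.

Let D_neq0 (p : 'I_3 -> K) : D.@[p] != 0 -> forall i, p i != 0.
Proof.
by rewrite meval_D !mulf_eq0 !negb_or => /andP[/andP[? ?] ?]; apply: I3P.
Qed.

Let local_q (p : 'I_3 -> K) i : D.@[p] != 0 -> local_ideal P p (q i).
Proof.
move=> Dp; have Xp : (X i).@[p] != 0 by rewrite mevalXU D_neq0.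
have ep : ((e i)%:MP_[3]).@[p] != 0 by rewrite mevalC.
apply: (local_ideal_cancel Xp); apply: (local_ideal_cancel ep).
by rewrite P_quadric; apply: local_idealD; apply: local_ideal_gen.
Qed.

Let lhs_ratfunE i : lhs_ratfun L b d i = tofrac (P i) / tofrac D.
Proof.
rewrite /lhs_ratfun lhs_numerator => [|j]; last first.
  (* The point with all coordinates 1 witnesses that an indeterminate is nonzero. *)
  apply: (@tofrac_neq0 _ _ (fun=> 1)).
  by rewrite mevalXU oner_eq0.
rewrite /D !tofracM; congr (_ / _).
rewrite /P rmorph_numerator /numerator /a.
by rewrite (rmorph_Lprime (@mpolyC 3 K)) rmorph_Lprime.
Qed.

Let solutionE (x : {ffun 'I_3 -> K}) :
  solution P D x <-> torus_solution L b d x.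
Proof.
have PE i : (P i).@[x] = numerator L a d x i.
  by rewrite /P (rmorph_numerator (meval x)) /numerator /= !mevalC !mevalXU.
split=> [/solutionP[Px Dx]|[x0 xL]].
  have x0 := D_neq0 Dx; split=> // i.
  by rewrite lhs_numerator // -PE Px mul0r.
have D0 : D.@[x] != 0 by rewrite meval_D !mulf_neq0.
apply/solutionP; split=> // i; have /eqP := xL i.
rewrite lhs_numerator // mulf_eq0 invr_eq0 -meval_D (negPf D0) orbF PE.
by move/eqP.
Qed.

Theorem torus_solutions_count4 : torus_solutions_count L b d 4.
Proof.
have AC := mulX_mx_comm c_diag.
have [||s [mu [s_uniq sP muP sum4]]] := solution_count AC mxeval_P mxeval_D
  (torus_one_basis c_diag c_minor c_inj) _ _ lhs_ratfunE.
- move=> p Dp i k; apply: local_mulX_mx => // j; exact: local_q.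
- move=> p Dp; exists 0; rewrite /torus_basis /= mevalXU; exact: D_neq0.
exists s, mu; split=> // x; rewrite sP; exact: solutionE.
Qed.

End TorusSystem.

(** * From the determinants to the nondegeneracy conditions *)

Lemma det_mx2 (R : comNzRingType) (a b c d : R) :
  \det (mx2 a b c d) = a * d - b * c.
Proof.
rewrite (expand_det_row _ 0) !big_ord_recl big_ord0 /cofactor !det_mx11 !mxE /=.
by rewrite expr0 expr1; ring.
Qed.

Lemma mx3_quadric_inj (K : fieldType) (L : K) (b d : 'I_3 -> K) :
  let a j := Lprime (b j) (d j) in
  \det (mx3 (4 * L) (a 0) (a 1) (a 0) (4 * L) (a 2) (a 1) (a 2) (4 * L)) != 0 ->
  forall y : 'I_3 -> K,
    (forall i, \sum_j quadric_mx L b d i j * y j = 0) -> forall i, y i = 0.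
Proof.
move=> a; set M := mx3 _ _ _ _ _ _ _ _ _ => detM y My.
have Mu : M \in unitmx by rewrite unitmxE unitfE.
(* The paper's matrix is that of the quadrics with the index order reversed. *)
have y0 : \col_i y (2 - i) = 0.
  apply: (can_inj (mulKmx Mu)); rewrite mulmx0; apply/colP => i.
  rewrite [RHS]mxE -[RHS](My (2 - i)) !mxE.
  elim/I3P: i; rewrite !sumI3 !mxE /quadric_mx /= ?subr0 ?subrr ?add_I3 /=;
    rewrite /a; ring.
move=> i; move/colP/(_ (2 - i)): y0; rewrite !mxE.
by rewrite opprB addrCA subrr addr0.
Qed.

Local Open Scope complex_scope.

Theorem proposition5p2 (R : realType) (L123 : R[i])
  (b : 'I_3 -> R[i]) (d : 'I_3 -> R) :
  let dC : 'I_3 -> R[i] := fun j => (d j)%:C in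
  let L111 := Lprime (b 0) (dC 0) in
  let L222 := Lprime (b 1) (dC 1) in
  let L333 := Lprime (b 2) (dC 2) in
  (forall j, 0 < d j) ->
  L123
  * \det (mx2 (4 * L123) L111
              L111 (4 * L123))
  * \det (mx2 (4 * L123) L222
              L222 (4 * L123))
  * \det (mx2 (4 * L123) L333
              L333 (4 * L123))
  * \det (mx3 (4 * L123) L111 L222
              L111 (4 * L123) L333
              L222 L333 (4 * L123)) != 0 ->
  torus_solutions_count L123 b dC 4.
Proof.
move=> dC L1 L2 L3 d_gt0; rewrite !mulf_eq0 !negb_or !det_mx2 -!expr2.
move=> /andP[/andP[/andP[/andP[L0 det1] det2] det3] detM].
apply: torus_solutions_count4 => //.
(* Positivity makes the pairwise sums of the [d j], which are divided by in the quadrics,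
   nonzero. *)
- move=> i; rewrite -rmorphD /= fmorph_eq0 gt_eqF // addr_gt0 //.
- by apply: I3P.
- exact: mx3_quadric_inj.
Qed.
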